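(* Let $\mathcal{M}$ be a compact topological space, let $k \in \mathbb{N}$, and let $f = (f_0, f_1, \dots, f_k) : \mathcal{M} \to \mathbb{R}^{k+1}$ be a continuous function. If $f$ is Lagrangian dual sectioned, then the optimal value function $V_f : \mathbb{R}^k \to \mathbb{R} \cup \{-\infty\}$ is concave.
   Context: Optimal value function: for $c \in \mathbb{R}^k$, $V_f(c) = \max\{ f_0(x) : f_1(x) = c_1, \dots, f_k(x) = c_k,\ x \in \mathcal{M}\}$, with $V_f(c) = -\infty$ if the feasible set is empty. Concavity of a function with values in $\mathbb{R}\cup\{-\infty\}$ is in the usual extended-valued sense (its hypograph is convex). Let $\mathbb{R}^{k+1}_{0+} := \{ t = (t_0, \dots, t_k) \in \mathbb{R}^{k+1} : t_0 \ge 0,\ t \neq 0\}$. A Lagrangian dual section of $f$ is a continuous function $D : \mathbb{R}^{k+1}_{0+} \to \mathcal{M}$ such that for every $t \in \mathbb{R}^{k+1}_{0+}$, $D(t)$ is a maximizer over $x \in \mathcal{M}$ of $\langle t, f(x) \rangle$ (the usual Euclidean inner product). The function $f$ is called Lagrangian dual sectioned (or sectioned) if a Lagrangian dual section exists. *)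

(* Defs.v *)
From mathcomp Require Import all_boot all_order all_algebra.
From mathcomp Require Import all_classical all_reals all_analysis.
Import Order.TTheory GRing.Theory Num.Theory.
Import numFieldNormedType.Exports.

Set Implicit Arguments.
Unset Strict Implicit.
Unset Printing Implicit Defensive.

Local Open Scope classical_set_scope.
Local Open Scope ring_scope.

Section LagrangianDualSections.
Variables (R : realType) (M : topologicalType) (k : nat).
Implicit Types (f : M -> 'rV[R]_k.+1) (c : 'rV[R]_k) (t : 'rV[R]_k.+1).

(* The component f_0 is [f x 0 ord0]; f_1, ..., f_k are the
   [f x 0 (lift ord0 i)] for i : 'I_k. *)
Definition feasible f c : set M :=
  [set x | forall i : 'I_k, f x 0 (lift ord0 i) = c 0 i].

(* The supremum over the empty set is -oo; when M is compact and f is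
   continuous, it is a maximum over any nonempty feasible set, see
   [optimal_value_max] below. *)
Definition optimal_value f c : \bar R :=
  ereal_sup [set (f x 0 ord0)%:E | x in feasible f c].

Definition inner t (u : 'rV[R]_k.+1) : R := \sum_(i < k.+1) t 0 i * u 0 i.

Definition R0plus : set 'rV[R]_k.+1 := [set t | 0 <= t 0 ord0 /\ t <> 0].

(* Only the values of D on R0plus matter. Totality of D is harmless: R0plus is
   nonempty, so a function from R0plus to M exists only if M is nonempty, and
   it then extends to all of 'rV[R]_k.+1. *)
Definition lagrangian_dual_section f (D : 'rV[R]_k.+1 -> M) : Prop :=
  {within R0plus, continuous D} /\
  forall t, R0plus t -> forall x, inner t (f x) <= inner t (f (D t)).

Definition sectioned f : Prop := exists D, lagrangian_dual_section f D.

Definition hypograph (V : 'rV[R]_k -> \bar R) : set ('rV[R]_k * R^o) :=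
  [set p | (p.2%:E <= V p.1)%E].

Definition concave (V : 'rV[R]_k -> \bar R) : Prop :=
  convex_set (hypograph V).

Lemma optimal_value_empty f c :
  feasible f c = set0 -> optimal_value f c = -oo%E.
Proof. by rewrite /optimal_value => ->; rewrite image_set0 ereal_sup0. Qed.

Lemma continuous_component f (j : 'I_k.+1) :
  continuous f -> continuous (fun x => f x 0 j).
Proof.
move=> cf x; apply: (@continuous_comp _ _ _ f (fun v : 'rV[R]_k.+1 => v 0 j)).
  exact: cf.
exact: coord_continuous.
Qed.

Lemma optimal_value_max f c :
  compact [set: M] -> continuous f -> feasible f c !=set0 ->
  exists x, [/\ feasible f c x,
    forall y, feasible f c y -> f y 0 ord0 <= f x 0 ord0
    & optimal_value f c = (f x 0 ord0)%:E].
Proof.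
move=> cM cf fc0.
have closed_fc : closed (feasible f c).
  rewrite (_ : feasible f c =
    \bigcap_(i in [set: 'I_k])
      ((fun x => f x 0 (lift ord0 i)) @^-1` [set c 0 i])).
    apply: closed_bigI => i _; apply: preimage_closed.
      by move=> x _; exact: continuous_component.
    exact: closed_eq.
  by apply/seteqP; split=> [x fx i _|x fx i]; exact: fx.
have [x xfc xmax] : exists2 x, x \in feasible f c &
    forall y, y \in feasible f c -> f y 0 ord0 <= f x 0 ord0.
  apply: (compact_EVT_max fc0).
    exact: subclosed_compact closed_fc cM (@subsetT _ _).
  by apply: continuous_subspaceT; exact: continuous_component.
rewrite inE in xfc.
exists x; split=> // [y yfc|]; first by apply: xmax; rewrite inE.
apply/eqP; rewrite eq_le; apply/andP; split.
  by apply: ge_ereal_sup => _ [y yfc <-]; rewrite lee_fin xmax// inE.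
by apply: ereal_sup_ubound; exists x.
Qed.

End LagrangianDualSections.

(* Main.v *)
(* Let w = (v, c) be a convex combination of two points of the hypograph. The
   support function S t = max_x <t, f x - w> is convex, nonnegative on t_0 = 1,
   and its gradient is G t = f (D t) - w, which is continuous because D is.
   Minimizing S t + eps / 2 * |t|^2 over t_0 = 1 gives a t with
   G_i t = - eps * t_i for i >= 1; then 0 <= <t, G t> forces 0 <= G_0 t, so D t
   is feasible for c up to an error tending to 0 with eps, and has value at
   least v. Compactness of M removes the error. *)
Require Import Defs.
From mathcomp Require Import all_boot all_order all_algebra.
From mathcomp Require Import all_classical all_reals all_analysis.
From mathcomp Require Import lra.
Import Order.TTheory GRing.Theory Num.Theory.
Import numFieldNormedType.Exports.
Local Open Scope classical_set_scope.
Local Open Scope ring_scope.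

(** * Bilinearity and continuity of the inner product *)

Section Inner.
Variables (R : realType) (k : nat).
Implicit Types t u v : 'rV[R]_k.+1.

Lemma innerC u v : inner u v = inner v u.
Proof. by apply: eq_bigr => i _; rewrite mulrC. Qed.

Lemma innerDr t u v : inner t (u + v) = inner t u + inner t v.
Proof. by rewrite -big_split; apply: eq_bigr => i _; rewrite mxE mulrDr. Qed.

Lemma innerZr t (a : R) u : inner t (a *: u) = a * inner t u.
Proof. by rewrite mulr_sumr; apply: eq_bigr => i _; rewrite mxE mulrCA. Qed.

Lemma innerBr t u v : inner t (u - v) = inner t u - inner t v.
Proof. by rewrite innerDr -scaleN1r innerZr mulN1r. Qed.

Lemma innerDl t u v : inner (u + v) t = inner u t + inner v t.
Proof. by rewrite innerC innerDr !(innerC t). Qed.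

Lemma innerZl t (a : R) u : inner (a *: u) t = a * inner u t.
Proof. by rewrite innerC innerZr (innerC t). Qed.

Lemma inner_ge0 u : 0 <= inner u u.
Proof. by apply: sumr_ge0 => i _; rewrite -expr2 sqr_ge0. Qed.

Lemma sqr_coord_le_inner u i : u 0 i ^+ 2 <= inner u u.
Proof.
rewrite /inner (bigD1 i)//= -expr2 lerDl.
by apply: sumr_ge0 => j _; rewrite -expr2 sqr_ge0.
Qed.

Lemma R0plus_gt0 u : 0 < u 0 ord0 -> R0plus u.
Proof.
move=> u0; split; first exact: ltW.
(* In [R0plus], [t <> 0] is elaborated as an inequality of functions
   ['I_1 -> 'I_k.+1 -> R], not of matrices. *)
move=> /(congr1 (fun h => h 0 ord0)); change (u 0 ord0 = 0 -> False).
by move=> u00; rewrite u00 ltxx in u0.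
Qed.

Lemma inner_delta0 u : inner (delta_mx 0 ord0) u = u 0 ord0.
Proof.
rewrite /inner big_ord_recl !mxE !eqxx mul1r big1 ?addr0// => i _.
by rewrite mxE /= mul0r.
Qed.

Lemma cvg_inner {T : Type} {F : set_system T} {FF : Filter F}
    (a b : T -> 'rV[R]_k.+1) u v :
  a @ F --> u -> b @ F --> v -> inner (a x) (b x) @[x --> F] --> inner u v.
Proof.
move=> au bv; apply: cvg_big => [|i _]; first exact: add_continuous.
apply: cvgM.
  by apply: (cvg_comp a (fun z : 'rV[R]_k.+1 => z 0 i) au);
    exact: coord_continuous.
by apply: (cvg_comp b (fun z : 'rV[R]_k.+1 => z 0 i) bv);
  exact: coord_continuous.
Qed.

End Inner.

(** * Regularized minimization over the slice [t 0 ord0 = 1] *)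

Section RegularizedMinimum.
Variables (R : realType) (k : nat) (G : 'rV[R]_k.+1 -> 'rV[R]_k.+1).
Implicit Types t u e : 'rV[R]_k.+1.

(** [G] abstracts [f (D t) - w]. By [G_max], [G t] is a subgradient at [t], along the slice, of the
    function sending [t] to [inner t (G t)]. *)
Hypothesis G_continuous : forall t, 0 < t 0 ord0 -> {for t, continuous G}.
Hypothesis G_max : forall t u, t 0 ord0 = 1 -> u 0 ord0 = 1 ->
  inner t (G u) <= inner t (G t).
Hypothesis G_ge0 : forall t, t 0 ord0 = 1 -> 0 <= inner t (G t).
Variable eps : R.
Hypothesis eps_gt0 : 0 < eps.

Let P t := inner t (G t) + eps / 2 * inner t t.

(** The slice is not compact, but [G_ge0] bounds [P] below by its quadratic term, so [P] is at least
    [P e0] outside a large box and a minimum over the box is global. *)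
Lemma regularized_minimizer :
  exists2 t : 'rV[R]_k.+1, t 0 ord0 = 1 & forall u, u 0 ord0 = 1 -> P t <= P u.
Proof.
pose e0 : 'rV[R]_k.+1 := delta_mx 0 ord0.
have e00 : e0 0 ord0 = 1 by rewrite mxE !eqxx.
have Pge u : u 0 ord0 = 1 -> eps / 2 * inner u u <= P u.
  by move=> u0; rewrite lerDr G_ge0.
have Pe0 : 0 <= P e0.
  by apply: le_trans (Pge _ e00); rewrite mulr_ge0 ?inner_ge0 ?divr_ge0 ?ltW.
(* The summand 1 gives [r <= r ^+ 2], so a coordinate of size above [r] already forces
   [eps / 2 * inner u u] to reach [P e0]. *)
pose r := 1 + 2 * P e0 / eps.
have Per : 0 <= 2 * P e0 / eps.
  by apply: divr_ge0; [exact: mulr_ge0 | exact: ltW].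
(* The degenerate interval at [ord0] keeps the box inside the slice. *)
pose I (i : 'I_k.+1) : set R :=
  if i == ord0 then [set` `[1, 1]] else [set` `[- r, r]].
pose K : set 'rV[R]_k.+1 := [set u | forall i, I i (u 0 i)].
have Kcompact : compact K.
  by apply: rV_compact => i; rewrite /I; case: ifP => _; exact: segment_compact.
have K0 u : K u -> u 0 ord0 = 1.
  by move=> /(_ ord0); rewrite /I eqxx /= in_itv/= -eq_le => /eqP.
have Ke0 : K e0.
  move=> i; rewrite /I; case: ifP => [/eqP ->|i0].
    by rewrite /= e00 in_itv/= lexx.
  by rewrite /= mxE i0 andbF in_itv/= /r; apply/andP; split; lra.
have [t] : exists2 c, c \in K & forall u, u \in K -> P c <= P u.
  apply: compact_EVT_min => //; first by exists e0.
  apply: continuous_in_subspaceT => u /set_mem/K0 u0.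
  have Gu : {for u, continuous G} by apply: G_continuous; rewrite u0.
  have uu : v @[v --> u] --> u by exact: cvg_id.
  exact: cvgD (cvg_inner _ _ _ _ _ _ uu Gu)
    (cvgM (cvg_cst _) (cvg_inner _ _ _ _ _ _ uu uu)).
rewrite inE => Kt tmin; exists t; first exact: K0.
move=> u u0; have [Ku|nKu] := pselect (K u); first by apply: tmin; rewrite inE.
apply: (@le_trans _ _ (P e0)); first by apply: tmin; rewrite inE.
apply: le_trans (Pge _ u0).
have [i [i0 ui]] : exists i, i != ord0 /\ r < `|u 0 i|.
  apply: contrapT => nex; apply: nKu => i; rewrite /I.
  case: ifPn => [/eqP ->|i0]; first by rewrite /= u0 in_itv/= lexx.
  rewrite /= in_itv/= -ler_norml leNgt; apply/negP => ri.
  by apply: nex; exists i.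
have r2 : 2 * P e0 / eps <= inner u u.
  apply: le_trans (sqr_coord_le_inner _ _ _ i); rewrite -real_normK ?num_real//.
  have r1 : 1 <= r by rewrite /r; lra.
  have : r <= r ^+ 2 by rewrite expr2 ler_peMr//; lra.
  have : r ^+ 2 <= `|u 0 i| ^+ 2 by rewrite ler_sqr ?nnegrE//; lra.
  by rewrite /r; lra.
move: r2; rewrite ler_pdivrMr//; lra.
Qed.

(** An envelope argument, without differentiating: compare [P] at [t] and [t + s *: e], bound
    [inner t (G (t + s *: e))] by [inner t (G t)] using [G_max], divide by [s], and let [s] tend to
    0 from the right. *)
Lemma minimizer_first_order t e :
  t 0 ord0 = 1 -> (forall u, u 0 ord0 = 1 -> P t <= P u) -> e 0 ord0 = 0 ->
  0 <= inner e (G t) + eps * inner t e.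
Proof.
move=> t0 tmin e0.
have step (s : R) : 0 < s ->
    0 <= inner e (G (t + s *: e)) + (eps * inner t e + eps / 2 * inner e e * s).
  move=> s0; rewrite -(pmulr_rge0 _ s0).
  have u0 : (t + s *: e) 0 ord0 = 1 by rewrite !mxE e0 mulr0 addr0.
  have := tmin _ u0; have := G_max _ _ t0 u0; rewrite /P.
  move: (G _) => g.
  rewrite !(innerDl, innerDr, innerZl, innerZr) (innerC _ _ e t).
  lra.
have c0 : t + s *: e @[s --> (0 : R)^'+] --> t + 0 *: e.
  apply: cvgD; first exact: cvg_cst.
  by apply: cvgZr_tmp; apply: cvg_within_filter; exact: cvg_id.
rewrite scale0r addr0 in c0.
have lim : inner e (G (t + s *: e)) +
    (eps * inner t e + eps / 2 * inner e e * s) @[s --> (0 : R)^'+] -->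
    inner e (G t) + (eps * inner t e + eps / 2 * inner e e * 0).
  apply: cvgD.
    apply: cvg_inner; first exact: cvg_cst.
    apply: (cvg_comp _ _ c0); apply: G_continuous.
    by rewrite t0.
  apply: cvgD; first exact: cvg_cst.
  by apply: cvgM; [exact: cvg_cst | apply: cvg_within_filter; exact: cvg_id].
rewrite mulr0 addr0 in lim.
apply: (cvgr_to_ge lim); near=> s; apply: step.
by near: s; exact: nbhs_right_gt.
Unshelve. all: by end_near. Qed.

(** The equations are stationarity along the slice; the norm bound comes from comparing [P t] with
    the value of [P] at [delta_mx 0 ord0]. *)
Lemma regularized_zero : exists t : 'rV[R]_k.+1, [/\ t 0 ord0 = 1,
  forall i : 'I_k, G t 0 (lift ord0 i) = - eps * t 0 (lift ord0 i) &
  eps * inner t t <= 2 * G (delta_mx 0 ord0) 0 ord0 + eps].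
Proof.
have [t t0 tmin] := regularized_minimizer.
exists t; split => //.
  (* Steepest descent direction within the slice: the first-order inequality becomes minus a sum of
     squares being nonnegative. *)
  pose e : 'rV[R]_k.+1 :=
    \row_i if i == ord0 then 0 else - (G t 0 i + eps * t 0 i).
  have e0 : e 0 ord0 = 0 by rewrite mxE.
  have := minimizer_first_order _ _ t0 tmin e0.
  rewrite (innerC _ _ t e) -innerZr -innerDr {1}/inner.
  rewrite big_ord_recl e0 mul0r add0r.
  rewrite -oppr_le0 -sumrN => le0 i.
  have /eqP : \sum_(j < k)
      (G t 0 (lift ord0 j) + eps * t 0 (lift ord0 j)) ^+ 2 = 0.
    apply/eqP; rewrite eq_le sumr_ge0 ?andbT => [|j _]; last exact: sqr_ge0.
    apply: le_trans le0; apply: ler_sum => j _.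
    by rewrite !mxE /= mulNr opprK expr2.
  rewrite psumr_eq0 => [|j _]; last exact: sqr_ge0.
  move=> /allP/(_ i (mem_index_enum _)); rewrite sqrf_eq0 => /eqP.
  lra.
have e00 : (delta_mx 0 ord0 : 'rV[R]_k.+1) 0 ord0 = 1 by rewrite mxE !eqxx.
have := tmin _ e00; have := G_ge0 _ t0.
rewrite /P !inner_delta0 e00; lra.
Qed.

End RegularizedMinimum.

(** * From approximate to exact domination of [w] *)

Section DominatingPoint.
Variables (R : realType) (M : topologicalType) (k : nat).
Variables (f : M -> 'rV[R]_k.+1) (D : 'rV[R]_k.+1 -> M) (w : 'rV[R]_k.+1).
Hypothesis f_continuous : continuous f.
Hypothesis D_section : lagrangian_dual_section f D.
Hypothesis w_le : forall t : 'rV[R]_k.+1, t 0 ord0 = 1 ->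
  inner t w <= inner t (f (D t)).

Let G t := f (D t) - w.

(** Relative continuity on [R0plus] becomes continuity at [t] because the open half-space
    [0 < u 0 ord0] lies in [R0plus]. *)
Lemma section_continuous (t : 'rV[R]_k.+1) :
  0 < t 0 ord0 -> {for t, continuous D}.
Proof.
move=> t0; pose A : set 'rV[R]_k.+1 := [set u | 0 < u 0 ord0].
have Aopen : open A.
  apply: (@open_comp _ _ (fun u : 'rV[R]_k.+1 => u 0 ord0) [set x | 0 < x]).
    by move=> u _; exact: coord_continuous.
  exact: open_gt.
have AR : A `<=` R0plus (R := R) (k := k) by exact: R0plus_gt0.
have := continuous_subspaceW AR D_section.1.
by rewrite continuous_open_subspace// => /(_ t); apply; rewrite inE.
Qed.

Lemma approx_dominating_point (eps : R) : 0 < eps ->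
  exists x, w 0 ord0 <= f x 0 ord0 /\
    \sum_(i < k) (f x 0 (lift ord0 i) - w 0 (lift ord0 i)) ^+ 2 <=
      eps * (2 * G (delta_mx 0 ord0) 0 ord0 + eps).
Proof.
move=> eps0.
have [||t t0|t [t0 Gt tt]] := @regularized_zero R k G _ _ _ eps eps0.
- move=> t t0.
  have Df := cvg_comp D f (section_continuous t t0) (f_continuous (D t)).
  exact: cvgB Df (cvg_cst _).
- move=> t u t0 u0; rewrite !innerBr lerD2r.
  by apply: D_section.2; apply: R0plus_gt0; rewrite t0.
- by rewrite innerBr subr_ge0 w_le.
have fG i : f (D t) 0 i - w 0 i = G t 0 i by rewrite !mxE.
have sum_ge0 : 0 <= \sum_(i < k) t 0 (lift ord0 i) ^+ 2.
  by apply: sumr_ge0 => i _; exact: sqr_ge0.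
exists (D t); split.
  (* Here [0 <= inner t (G t)] reads [0 <= G t 0 ord0 - eps * S], with [S] the sum of the other
     squared coordinates of [t]. *)
  have := w_le _ t0; rewrite -subr_ge0 -innerBr -/(G t) {1}/inner big_ord_recl.
  rewrite t0 mul1r -[w _ _ <= _]subr_ge0 fG.
  under eq_bigr => i _ do rewrite Gt mulrCA -expr2.
  rewrite -mulr_sumr; nra.
(* The error is [eps ^+ 2] times that sum, hence at most [eps * (eps * inner t t)]. *)
under eq_bigr => i _ do rewrite fG Gt exprMn sqrrN.
rewrite -mulr_sumr expr2 -mulrA ler_pM2l//; apply: le_trans tt.
rewrite ler_pM2l// /inner big_ord_recl.
under [X in _ <= _ + X]eq_bigr => i _ do rewrite -expr2.
by rewrite lerDr -expr2 sqr_ge0.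
Qed.

(** The squared error [phi] attains its minimum on the compact set [A]; approximate solutions with
    arbitrarily small [eps] force this minimum to be 0. *)
Lemma dominating_point : compact [set: M] ->
  exists2 x, w 0 ord0 <= f x 0 ord0 &
    forall i : 'I_k, f x 0 (lift ord0 i) = w 0 (lift ord0 i).
Proof.
move=> cM; pose A := [set x | w 0 ord0 <= f x 0 ord0].
pose phi x := \sum_(i < k) (f x 0 (lift ord0 i) - w 0 (lift ord0 i)) ^+ 2.
have phi_ge0 x : 0 <= phi x by apply: sumr_ge0 => i _; exact: sqr_ge0.
have [x xA xmin] : exists2 x, x \in A & forall y, y \in A -> phi x <= phi y.
  apply: compact_EVT_min.
  - by have [x [wx _]] := approx_dominating_point _ (@ltr01 R); exists x.
  - apply: (subclosed_compact _ cM) => //.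
    rewrite (_ : A = (fun x => f x 0 ord0) @^-1` [set r | w 0 ord0 <= r])//.
    apply: preimage_closed; last exact: closed_ge.
    by move=> x _; exact: continuous_component.
  - apply: continuous_subspaceT => x; apply: cvg_big => [|i _].
      exact: add_continuous.
    apply: cvgM; apply: cvgB; try exact: cvg_cst.
      exact: continuous_component.
    exact: continuous_component.
rewrite inE in xA; exists x => //.
pose C := G (delta_mx 0 ord0) 0 ord0.
have C0 : 0 <= C.
  rewrite /C -inner_delta0 innerBr subr_ge0; apply: w_le.
  by rewrite mxE !eqxx.
have phi_small eps : 0 < eps -> phi x <= eps * (2 * C + eps).
  move=> /approx_dominating_point[y [wy phiy]]; apply: le_trans phiy.
  by apply: xmin; rewrite inE.
have phix0 : phi x = 0.
  apply/eqP; rewrite eq_le phi_ge0 andbT leNgt; apply/negP => phix.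
  (* With [eps] equal to [phi x] over this denominator, [eps < 1], so [2 * C + eps] is below the
     denominator and [eps * (2 * C + eps) < phi x]. *)
  have d0 : 0 < 2 * C + 1 + phi x by lra.
  have := phi_small _ (divr_gt0 phix d0); apply/negP; rewrite -ltNge.
  rewrite mulrAC ltr_pdivrMr// ltr_pM2l//.
  have : phi x / (2 * C + 1 + phi x) < 1 by rewrite ltr_pdivrMr//; lra.
  lra.
move=> i; apply/eqP; rewrite -subr_eq0 -sqrf_eq0.
move/eqP: phix0; rewrite psumr_eq0 => [|j _]; last exact: sqr_ge0.
by move=> /allP/(_ i (mem_index_enum _)).
Qed.

End DominatingPoint.

(** * Convexity of the hypograph *)

Theorem theorem1p1 (R : realType) (M : topologicalType) (k : nat)
    (f : M -> 'rV[R]_k.+1) (compactM : compact [set: M])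
    (continuous_f : continuous f) (sectioned_f : sectioned f) :
  concave (optimal_value f).
Proof.
have [D Dsec] := sectioned_f.
(* Attainment of the maximum turns a hypograph point into a feasible witness; an empty feasible set
   would put a real number below [-oo]. *)
have hypoP (p : 'rV[R]_k * R^o) : hypograph (optimal_value f) p ->
    exists x, feasible f p.1 x /\ p.2 <= f x 0 ord0.
  rewrite /hypograph/= => pV.
  have [|ne] := eqVneq (feasible f p.1) set0.
    by move=> /optimal_value_empty fE; move: pV; rewrite fE.
  have /set0P fne := ne.
  have [x [fx _ Vx]] := optimal_value_max compactM continuous_f fne.
  by exists x; split => //; move: pV; rewrite Vx lee_fin.
move=> p q l; rewrite !inE => /hypoP[x [fx px]] /hypoP[y [fy qy]].
have l0 : 0 <= l%:num by apply: ge0.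
have l1 : 0 <= 1 - l%:num by rewrite subr_ge0; apply: le1.
set a := l%:num in l0 l1 *.
pose v := a * p.2 + (1 - a) * q.2.
pose c := a *: p.1 + (1 - a) *: q.1.
pose w : 'rV[R]_k.+1 := \row_i
  if unlift ord0 i is Some j then c 0 j else v.
have w0 : w 0 ord0 = v by rewrite mxE unlift_none.
have wS i : w 0 (lift ord0 i) = c 0 i by rewrite mxE liftK.
have [t t0|z] := @dominating_point R M k f D w continuous_f Dsec _ compactM.
  have Rt : R0plus t by apply: R0plus_gt0; rewrite t0.
  (* Only coordinate 0 of [w] can differ from the combination of [f x] and [f y]; it is no larger
     there and has weight 1. Maximality of [D t] against [x] and [y] then concludes. *)
  have wle : inner t w <= inner t (a *: f x + (1 - a) *: f y).
    rewrite /inner !big_ord_recl t0 w0 !mxE !mul1r lerD//.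
      by rewrite /v lerD// ler_wpM2l.
    by apply: ler_sum => i _; rewrite wS !mxE fx fy.
  apply: le_trans wle _; rewrite innerDr !innerZr.
  have := ler_wpM2l l0 (Dsec.2 _ Rt x).
  have := ler_wpM2l l1 (Dsec.2 _ Rt y).
  lra.
rewrite w0 => vz zc.
rewrite /hypograph/=; apply: (@le_trans _ _ (f z 0 ord0)%:E).
  by rewrite lee_fin.
apply: ereal_sup_ubound; exists z => // i.
by rewrite zc wS.
Qed.
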